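(* Let $R$ be a non-commutative ring with unity and let $A \in M_2(R)$. Then $A$ is a (finite) sum of fifth powers of matrices in $M_2(R)$ if and only if $\operatorname{tr}(A)$ can be written as a finite sum of fifth powers of elements of $R$ and cyclic sums $C(a_1,a_2,a_3,a_4,a_5)$ with $(a_1,a_2,a_3,a_4,a_5) \in S_{5,2}$.
   Context: $M_2(R)$ is the ring of $2\times 2$ matrices over $R$, and $\operatorname{tr}$ denotes the sum of the diagonal entries. For $a_1,\dots,a_5\in R$ the cyclic sum (''five-cycle'') is $$C(a_1,a_2,a_3,a_4,a_5)=a_1a_2a_3a_4a_5+a_5a_1a_2a_3a_4+a_4a_5a_1a_2a_3+a_3a_4a_5a_1a_2+a_2a_3a_4a_5a_1 .$$ $S_{5,2}\subset R^5$ is the set of all 5-tuples of one of the two types (A) $(a,b,c,d,a)$ or (B) $(a,b,a,c,d)$, with $a,b,c,d\in R$ arbitrary (not necessarily distinct). A five-cycle from $S_{5,2}$ is the cyclic sum of such a tuple; it does not change under cyclic rotation of the tuple. *)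

(* Defs.v *)
From HB Require Import structures.
From mathcomp Require Import all_boot all_order all_algebra.
Set Implicit Arguments.
Unset Strict Implicit.
Unset Printing Implicit Defensive.
Import GRing.Theory.
Local Open Scope ring_scope.

Definition sum_of_fifth_powers (T : pzRingType) (x : T) : Prop :=
  exists s : seq T, x = \sum_(y <- s) y ^+ 5.

Definition five_cycle (R : pzRingType) (u : R * R * R * R * R) : R :=
  let: (a1, a2, a3, a4, a5) := u in
  a1 * a2 * a3 * a4 * a5 + a5 * a1 * a2 * a3 * a4 + a4 * a5 * a1 * a2 * a3
  + a3 * a4 * a5 * a1 * a2 + a2 * a3 * a4 * a5 * a1.

Definition S52 (R : pzRingType) (u : R * R * R * R * R) : Prop :=
  (exists a b c d : R, u = (a, b, c, d, a))
  \/ (exists a b c d : R, u = (a, b, a, c, d)).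

Definition sum_of_fifth_powers_and_five_cycles (R : pzRingType) (x : R) : Prop :=
  exists (s : seq R) (t : seq (R * R * R * R * R)),
    (forall u, u \in t -> S52 u)
    /\ x = \sum_(y <- s) y ^+ 5 + \sum_(u <- t) five_cycle u.

(* Main.v *)
Require Import Defs.
From HB Require Import structures.
From mathcomp Require Import all_boot all_order all_algebra.
Set Implicit Arguments.
Unset Strict Implicit.
Unset Printing Implicit Defensive.
Import GRing.Theory.
Local Open Scope ring_scope.

(* Sums of fifth powers form an additive subgroup G of M_2(R). Idempotents are fifth powers, so G contains all off-diagonal matrices and all diag(yx, -xy), hence every matrix of trace zero and all diag(xy - yx, 0); thus membership in G depends only on the trace, and the set T of traces of G contains the additive commutators. The trace of M^5 is a sum of two fifth powers and six five-cycles of the allowed types, which gives one direction. Conversely a five-cycle is congruent to 5 a_1 a_2 a_3 a_4 a_5 modulo commutators, so it remains to see 5R in T; this comes from the traces of fifth powers of [[a, 1], [c, 0]]. *)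

(* Loops if a summand occurs twice on the right. *)
Ltac cancel_sums :=
  repeat match goal with |- ?x + _ = _ =>
    rewrite ?[in RHS](addrCA _ x); congr (x + _)
  end.

(** * Additive group of sums of fifth powers *)

Section SumOfFifthPowers.
Variable T : pzRingType.
Implicit Types x y : T.

Lemma sofp_exp x : sum_of_fifth_powers (x ^+ 5).
Proof. by exists [:: x]; rewrite big_seq1. Qed.

Lemma sofp0 : sum_of_fifth_powers (0 : T).
Proof. by exists [::]; rewrite big_nil. Qed.

Lemma sofpD x y :
  sum_of_fifth_powers x -> sum_of_fifth_powers y -> sum_of_fifth_powers (x + y).
Proof. by move=> [s ->] [t ->]; exists (s ++ t); rewrite big_cat. Qed.

(** Since 5 is odd, the sign moves inside each fifth power. *)
Lemma sofpN x : sum_of_fifth_powers x -> sum_of_fifth_powers (- x).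
Proof.
move=> [s ->]; exists (map -%R s); rewrite big_map -sumrN.
by apply: eq_bigr => y _; rewrite exprNn -signr_odd mulN1r.
Qed.

Lemma sofpB x y :
  sum_of_fifth_powers x -> sum_of_fifth_powers y -> sum_of_fifth_powers (x - y).
Proof. by move=> ? /sofpN; apply: sofpD. Qed.

Lemma sofp_idem x : x * x = x -> sum_of_fifth_powers x.
Proof.
move=> xx; have -> : x = x ^+ 5 by rewrite !exprS expr0 mulr1 !xx.
exact: sofp_exp.
Qed.

End SumOfFifthPowers.

Section Matrix2.
Variable R : pzRingType.
Implicit Types (a b c d x y z t : R) (A M : 'M[R]_2).

Definition mx2 a b c d : 'M[R]_2 :=
  \matrix_(i, j) if i == 0 then if j == 0 then a else b
                 else if j == 0 then c else d.

Lemma mx2_eta A : A = mx2 (A 0 0) (A 0 1) (A 1 0) (A 1 1).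
Proof.
apply/matrixP => i j; rewrite mxE.
have E (k : 'I_2) : k = if k == 0 then 0 else 1.
  by apply: val_inj; case: k => [[|[|]]].
by rewrite {1}(E i) {1}(E j); case: (i == 0); case: (j == 0).
Qed.

Lemma mx2D a b c d a' b' c' d' :
  mx2 a b c d + mx2 a' b' c' d' = mx2 (a + a') (b + b') (c + c') (d + d').
Proof. by apply/matrixP => i j; rewrite !mxE; do 2!case: ifP. Qed.

Lemma mx2N a b c d : - mx2 a b c d = mx2 (- a) (- b) (- c) (- d).
Proof. by apply/matrixP => i j; rewrite !mxE; do 2!case: ifP. Qed.

Lemma mx2M a b c d a' b' c' d' :
  mx2 a b c d * mx2 a' b' c' d' =
  mx2 (a * a' + b * c') (a * b' + b * d') (c * a' + d * c') (c * b' + d * d').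
Proof.
apply/matrixP => i j; rewrite !mxE !big_ord_recl big_ord0 !mxE addr0 /=.
by do 2!case: ifP.
Qed.

Lemma mxtrace_mx2 a b c d : \tr (mx2 a b c d) = a + d.
Proof. by rewrite /mxtrace !big_ord_recl big_ord0 !mxE addr0. Qed.

Definition mx2E := (mx2M, mx2N, mx2D).

(* The six products are the closed walks of length 5 on two vertices that are not constant, up to rotation, each written in one of the forms allowed by [S52]. *)
Lemma mxtrace_exp5 a b c d :
  \tr (mx2 a b c d ^+ 5) = a ^+ 5 + d ^+ 5 +
    \sum_(u <- [:: (a, b, c, a, a); (a, b, d, c, a); (b, c, b, c, a);
                   (d, c, a, b, d); (c, b, c, b, d); (d, c, b, d, d)])
      five_cycle u.
Proof.
rewrite !exprS !expr0 !mulr1 !mx2M mxtrace_mx2 !big_cons big_nil /=.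
rewrite !(mulrDl, mulrDr) !mulrA -!addrA.
rewrite -[X in _ = X]addr0 -!addrA.
cancel_sums.
by rewrite !addr0.
Qed.

(** * Reduction to the trace *)

Lemma sofp_mx2_upper b : sum_of_fifth_powers (mx2 0 b 0 0).
Proof.
have -> : mx2 0 b 0 0 = mx2 1 b 0 0 - mx2 1 0 0 0.
  by rewrite !mx2E !oppr0 !addr0 subrr.
by apply: sofpB; apply: sofp_idem; rewrite mx2E !(mul0r, mulr0, mul1r, addr0).
Qed.

Lemma sofp_mx2_lower c : sum_of_fifth_powers (mx2 0 0 c 0).
Proof.
have -> : mx2 0 0 c 0 = mx2 1 0 c 0 - mx2 1 0 0 0.
  by rewrite !mx2E !oppr0 !addr0 subrr.
by apply: sofpB; apply: sofp_idem;
  rewrite mx2E !(mul0r, mulr0, mulr1, mul1r, addr0).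
Qed.

(* The idempotent is [mx2 1 0 0 0] conjugated by the product of the transvections [mx2 1 y 0 1] and [mx2 1 0 x 1]. *)
Lemma sofp_mx2_swap x y : sum_of_fifth_powers (mx2 (y * x) 0 0 (- (x * y))).
Proof.
set u := 1 + y * x.
have -> : mx2 (y * x) 0 0 (- (x * y)) =
    mx2 u (- (u * y)) x (- (x * y)) - mx2 1 0 0 0
    + mx2 0 (u * y) 0 0 - mx2 0 0 x 0.
  by rewrite !mx2E !oppr0 !addr0 addNr subrr addrAC subrr add0r.
apply: sofpB (sofp_mx2_lower x); apply: sofpD (sofp_mx2_upper _).
apply: sofpB; apply: sofp_idem; rewrite mx2E ?(mul0r, mulr0, mul1r, addr0) //.
(* The idempotent is the column [(u, x)] times the row [(1, - y)], and the row times the column is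
   [u - y * x = 1]. [E] and [F] apply this relation entrywise. *)
have E z : z * u - z * y * x = z by rewrite mulrDr mulr1 mulrA addrK.
have F z : z * - (u * y) + - (z * y) * - (x * y) = - (z * y).
  rewrite mulrN mulrA mulNr mulrN opprK mulrA -[in RHS](E z).
  by rewrite mulrBl opprB addrC.
by rewrite !F !mulNr !E.
Qed.

Definition fifth_trace x := sum_of_fifth_powers (mx2 x 0 0 0).

Lemma sofp_trace A : sum_of_fifth_powers A <-> fifth_trace (\tr A).
Proof.
(* [B] is [A] minus the corner matrix of its trace; its diagonal comes from [sofp_mx2_swap] with one
   factor equal to 1. *)
set B := mx2 0 (A 0 1) 0 0 + mx2 0 0 (A 1 0) 0
         - mx2 (A 1 1 * 1) 0 0 (- (1 * A 1 1)).
have sB : sum_of_fifth_powers B.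
  apply: sofpB (sofp_mx2_swap _ _).
  exact: sofpD (sofp_mx2_upper _) (sofp_mx2_lower _).
have EA : A = mx2 (\tr A) 0 0 0 + B.
  rewrite {1 2}[A]mx2_eta mxtrace_mx2 /B !mx2E.
  by rewrite mulr1 mul1r !(addr0, add0r, oppr0) opprK addrK.
split=> [sA|/sofpD/(_ sB)]; last by rewrite -EA.
by have := sofpB sA sB; rewrite {1}EA addrK.
Qed.

Lemma fifth_traceD x y : fifth_trace x -> fifth_trace y -> fifth_trace (x + y).
Proof. by move=> /sofpD h /h; rewrite mx2D !addr0. Qed.

Lemma fifth_traceN x : fifth_trace x -> fifth_trace (- x).
Proof. by move=> /sofpN; rewrite mx2N !oppr0. Qed.

Lemma fifth_trace0 : fifth_trace 0.
Proof. by have := sofp0 'M[R]_2; rewrite [0]mx2_eta !mxE. Qed.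

Lemma fifth_trace_sum (I : eqType) (r : seq I) (F : I -> R) :
  (forall i, i \in r -> fifth_trace (F i)) -> fifth_trace (\sum_(i <- r) F i).
Proof.
by move=> TF; rewrite big_seq; apply: big_ind TF;
  [exact: fifth_trace0 | exact: fifth_traceD].
Qed.

Lemma fifth_trace_mxtrace M : fifth_trace (\tr (M ^+ 5)).
Proof. exact: (sofp_trace _).1 (sofp_exp _). Qed.

Lemma fifth_trace_exp x : fifth_trace (x ^+ 5).
Proof.
have := fifth_trace_mxtrace (mx2 x 0 0 0).
by rewrite !exprS !expr0 !mulr1 !mx2E !(mul0r, mulr0, addr0) mxtrace_mx2 addr0.
Qed.

Lemma fifth_trace_comm x y : fifth_trace (x * y - y * x).
Proof.
(* Both matrices have lower right entry [- (y * x)], which cancels. *)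
have := sofpB (sofp_mx2_swap y x) (sofp_mx2_swap 1 (y * x)).
by rewrite !mx2E !(mulr1, mul1r) !subr0 subrr.
Qed.

Definition prod5 (u : R * R * R * R * R) : R :=
  let: (a1, a2, a3, a4, a5) := u in a1 * a2 * a3 * a4 * a5.

(** A rotation turns a product [p * q] into [q * p], so each of the five summands differs from
    [prod5 u] by a commutator. *)
Lemma fifth_trace_five_cycleB u :
  fifth_trace (five_cycle u - prod5 u *+ 5).
Proof.
case: u => [[[[a1 a2] a3] a4] a5] /=; set w := a1 * _ * _ * _ * _.
have T_sumB (s : seq R) : (forall x, x \in s -> fifth_trace (x - w)) ->
    fifth_trace (\sum_(x <- s) x - w *+ size s).
  by move/fifth_trace_sum; rewrite sumrB big_const_seq count_predT iter_addr_0.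
have := T_sumB [:: w; a5 * a1 * a2 * a3 * a4; a4 * a5 * a1 * a2 * a3;
                   a3 * a4 * a5 * a1 * a2; a2 * a3 * a4 * a5 * a1].
rewrite !big_cons big_nil addr0 !addrA; apply=> x.
rewrite !inE => /or4P[/eqP->|/eqP->|/eqP->|/orP[]/eqP->].
- by rewrite subrr; apply: fifth_trace0.
- by have := fifth_trace_comm a5 (a1 * a2 * a3 * a4); rewrite !mulrA.
- by have := fifth_trace_comm (a4 * a5) (a1 * a2 * a3); rewrite !mulrA.
- by have := fifth_trace_comm (a3 * a4 * a5) (a1 * a2); rewrite !mulrA.
- by have := fifth_trace_comm (a2 * a3 * a4 * a5) a1; rewrite !mulrA.
Qed.

(** * Multiples of five are traces *)

Definition fifth_trace5 x := fifth_trace (x *+ 5).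

Lemma fifth_trace5D x y :
  fifth_trace5 x -> fifth_trace5 y -> fifth_trace5 (x + y).
Proof. by move=> /fifth_traceD h /h; rewrite -mulrnDl. Qed.

Lemma fifth_trace5_cancel x y :
  fifth_trace5 y -> fifth_trace5 (x + y) -> fifth_trace5 x.
Proof.
move=> /fifth_traceN Ty /fifth_traceD/(_ Ty).
by rewrite mulrnDl addrK.
Qed.

(** For [b = 1] and [d = 0], only the walks [(a, 1, c, a, a)] and [(1, c, 1, c, a)] have nonzero
    products in [mxtrace_exp5]. *)
Lemma fifth_trace5_companion a c : fifth_trace5 (a * c * a * a + c * c * a).
Proof.
have := fifth_trace_mxtrace (mx2 a 1 c 0); rewrite mxtrace_exp5 expr0n addr0.
set s := (X in \sum_(u <- X) _) => TM.
have : fifth_trace (\sum_(u <- s) (five_cycle u - prod5 u *+ 5)).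
  by apply: fifth_trace_sum => u _; apply: fifth_trace_five_cycleB.
rewrite sumrB sumrMnl => /fifth_traceN/fifth_traceD/(_ TM).
move=> /fifth_traceD/(_ (fifth_traceN (fifth_trace_exp a))).
rewrite opprB [a ^+ 5 + _]addrC addrA subrK addrK.
by rewrite /s !big_cons big_nil /= !(mulr1, mulr0, mul0r, mul1r, addr0, add0r).
Qed.

Lemma fifth_trace5_sqr x : fifth_trace5 (x + x ^+ 2).
Proof. by have := fifth_trace5_companion 1 x; rewrite !(mulr1, mul1r). Qed.

Lemma fifth_trace5_cube x : fifth_trace5 (x ^+ 3 + x).
Proof.
have := fifth_trace5_companion x 1.
by rewrite !(mulr1, mul1r) !exprSr expr0 mul1r.
Qed.

(** Linearization: replacing [x] by [x + 1] in [x + x ^+ 2] produces the cross term [x *+ 2]. *)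
Lemma fifth_trace5_double x : fifth_trace5 (x *+ 2).
Proof.
apply: (fifth_trace5_cancel (fifth_trace5_sqr x)).
apply: (fifth_trace5_cancel (fifth_trace5_sqr 1)).
have := fifth_trace5_sqr (x + 1); congr fifth_trace5.
rewrite expr1n sqrrD1 -!addrA.
cancel_sums.
Qed.

(* Modulo [fifth_trace5], squaring and cubing act as the identity, so doubling gives 0, and expanding the cube of [t + t ^+ 2] gives [t = t ^+ 5]. *)
Lemma fifth_trace5_all t : fifth_trace5 t.
Proof.
have T5 n : fifth_trace5 (t ^+ 5 *+ n).
  rewrite /fifth_trace5 -mulrnA; elim: (n * 5)%N => [|k IH].
    exact: fifth_trace0.
  by rewrite mulrS; apply: fifth_traceD IH; apply: fifth_trace_exp.
apply: (fifth_trace5_cancel (fifth_trace5_sqr (t ^+ 2))).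
rewrite -exprM addrA; apply: fifth_trace5D (fifth_trace5_sqr t) _.
apply: (fifth_trace5_cancel (fifth_trace5_double (t ^+ (2 * 2)))).
(* What is left is [t ^+ 4 *+ 3]; the terms added next complete it to
   [(t + t ^+ 2) ^+ 3 + (t + t ^+ 2)]. *)
rewrite -mulrS.
apply: (fifth_trace5_cancel (fifth_trace5_sqr (t ^+ 3))).
apply: (fifth_trace5_cancel (T5 3%N)).
apply: (fifth_trace5_cancel (fifth_trace5_sqr t)).
have := fifth_trace5_cube (t + t ^+ 2).
congr fifth_trace5; congr (_ + _).
rewrite exprDn_comm; last exact: commrX.
rewrite !big_ord_recl big_ord0 /= /bump /= !binS !bin0 !bin0n /=.
rewrite -!exprM -!exprD !addnE !mulnE /= !mulr1n addr0.
by rewrite [LHS]addrCA -[RHS]addrA; congr (_ + _); rewrite addrA addrAC.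
Qed.

Lemma fifth_trace_five_cycle u : fifth_trace (five_cycle u).
Proof.
rewrite -[five_cycle u](subrK (prod5 u *+ 5)).
exact: fifth_traceD (fifth_trace_five_cycleB u) (fifth_trace5_all _).
Qed.

(** * Traces of fifth powers in terms of five-cycles *)

Lemma sum_of_fifth_powers_and_five_cyclesD x y :
  sum_of_fifth_powers_and_five_cycles x ->
  sum_of_fifth_powers_and_five_cycles y ->
  sum_of_fifth_powers_and_five_cycles (x + y).
Proof.
move=> [s [u [Hu ->]]] [t [v [Hv ->]]]; exists (s ++ t), (u ++ v); split.
  by move=> w; rewrite mem_cat => /orP[/Hu|/Hv].
by rewrite !big_cat /= addrACA.
Qed.

Lemma sum_of_fifth_powers_and_five_cycles_mxtrace M :
  sum_of_fifth_powers_and_five_cycles (\tr (M ^+ 5)).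
Proof.
rewrite [M]mx2_eta mxtrace_exp5; set a := M 0 0; set b := M 0 1.
set c := M 1 0; set d := M 1 1; set t := (X in \sum_(u <- X) _).
exists [:: a; d], t; split; last by congr (_ + _); rewrite !big_cons big_nil addr0.
move=> u; rewrite /t !inE.
(* The third and fifth tuples repeat their first entry in third place, the other four in last
   place. *)
by move=> /or4P[/eqP->|/eqP->|/eqP->|/or3P[]/eqP->]; rewrite /S52;
  [left | left | right | left | right | left]; do 4 eexists.
Qed.

End Matrix2.

Theorem theorem5 (R : pzRingType) (A : 'M[R]_2) :
  sum_of_fifth_powers A <-> sum_of_fifth_powers_and_five_cycles (\tr A).
Proof.
split=> [[s ->]|[s [t [_ trA]]]].
  rewrite raddf_sum; apply: big_ind => [|x y|M _].
  - by exists [::], [::]; split=> //; rewrite !big_nil addr0.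
  - exact: sum_of_fifth_powers_and_five_cyclesD.
  - exact: sum_of_fifth_powers_and_five_cycles_mxtrace.
apply/sofp_trace; rewrite trA; apply: fifth_traceD; apply: fifth_trace_sum.
- by move=> x _; apply: fifth_trace_exp.
- by move=> u _; apply: fifth_trace_five_cycle.
Qed.
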